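(* Consider the colored structured system $(\mathcal{A},\mathcal{B},\pi)$, with $\mathcal{A}\in\{0,\ast,?\}^{n\times n}$, $\mathcal{B}\in\{0,\ast,?\}^{n\times m}$ and $\pi$ a coloring of $\begin{bmatrix}\mathcal{A}&\mathcal{B}\end{bmatrix}$. Let $(\begin{bmatrix}\bar{\mathcal{A}}&\mathcal{B}\end{bmatrix},\bar\pi)$ be the colored pattern matrix associated with $(\mathcal{A},\mathcal{B},\pi)$ as defined in the context. Then $(\mathcal{A},\mathcal{B},\pi)$ is controllable (i.e. strongly structurally controllable) if both graphs $\mathcal{G}(\begin{bmatrix}\mathcal{A}&\mathcal{B}\end{bmatrix},\pi)$ and $\mathcal{G}(\begin{bmatrix}\bar{\mathcal{A}}&\mathcal{B}\end{bmatrix},\bar\pi)$ are colorable.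
   Context: A pattern matrix is a matrix with entries in the set of symbols $\{0,\ast,?\}$. Let $\mathcal{M}\in\{0,\ast,?\}^{p\times q}$ with $p\le q$. Let $\mathcal{I}_{\mathcal M}(\ast)$ and $\mathcal{I}_{\mathcal M}(?)$ be the sets of locations $(i,j)$ with $\mathcal{M}_{ij}=\ast$, respectively $\mathcal{M}_{ij}=?$. A coloring of $\mathcal{M}$ is $\pi=\{\mathcal{I}^\ast_1,\ldots,\mathcal{I}^\ast_k,\mathcal{I}^?_1,\ldots,\mathcal{I}^?_l\}$, where $\{\mathcal{I}^\ast_1,\ldots,\mathcal{I}^\ast_k\}$ is a partition of $\mathcal{I}_{\mathcal M}(\ast)$ and $\{\mathcal{I}^?_1,\ldots,\mathcal{I}^?_l\}$ is a partition of $\mathcal{I}_{\mathcal M}(?)$; $(\mathcal{M},\pi)$ is called a colored pattern matrix. The colored pattern class $\mathcal{P}(\mathcal{M},\pi)$ is the set of all $M\in\mathbb{R}^{p\times q}$ such that $M_{ij}=0$ if $\mathcal{M}_{ij}=0$; $M_{ij}\ne 0$ if $\mathcal{M}_{ij}=\ast$ (entries with $\mathcal{M}_{ij}=?$ may be zero or nonzero); and $M_{ij}=M_{mn}$ whenever $(i,j),(m,n)$ belong to the same set $\mathcal{I}^\ast_r$ or to the same set $\mathcal{I}^?_s$. Colored structured system: for $\mathcal{A}\in\{0,\ast,?\}^{n\times n}$, $\mathcal{B}\in\{0,\ast,?\}^{n\times m}$ and a coloring $\pi=\{\mathcal{I}^\ast_1,\ldots,\mathcal{I}^\ast_k,\mathcal{I}^?_1,\ldots,\mathcal{I}^?_l\}$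 of $\begin{bmatrix}\mathcal{A}&\mathcal{B}\end{bmatrix}$, the colored structured system $(\mathcal{A},\mathcal{B},\pi)$ is the family of all pairs $(A,B)$ with $\begin{bmatrix}A&B\end{bmatrix}\in\mathcal{P}(\begin{bmatrix}\mathcal{A}&\mathcal{B}\end{bmatrix},\pi)$, each representing the linear system $\dot x=Ax+Bu$ with state $x\in\mathbb{R}^n$ and input $u\in\mathbb{R}^m$. It is called strongly structurally controllable, or simply controllable, if $(A,B)$ is controllable (in the usual Kalman sense) for every such pair. Definition of $(\begin{bmatrix}\bar{\mathcal{A}}&\mathcal{B}\end{bmatrix},\bar\pi)$: $\bar{\mathcal{A}}$ is obtained from $\mathcal{A}$ by changing only the diagonal entries: $\bar{\mathcal{A}}_{ii}=\ast$ if $\mathcal{A}_{ii}=0$, and $\bar{\mathcal{A}}_{ii}=?$ otherwise; $\mathcal{B}$ is unchanged. For $r=1,\ldots,k$ and $s=1,\ldots,l$ put $\bar{\mathcal{I}}^\ast_r=\{(i,j)\in\mathcal{I}^\ast_r\mid i\ne j\}$ and $\bar{\mathcal{I}}^?_s=\{(i,j)\in\mathcal{I}^?_s\mid i\neq j\}$ (some of these may be empty). If $i_1,\ldots,i_w$ are the indices $i$ with $\bar{\mathcal{A}}_{ii}=\ast$, put $\bar{\mathcal{I}}^\ast_{k+j}=\{(i_j,i_j)\}$ for $j=1,\ldots,w$; if $t_1,\ldots,t_{n-w}$ are the indices $i$ with $\bar{\mathcal{A}}_{ii}=?$, put $\bar{\mathcal{I}}^?_{l+j}=\{(t_j,t_j)\}$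 for $j=1,\ldots,n-w$. Then $\bar\pi=\{\bar{\mathcal{I}}^\ast_1,\ldots,\bar{\mathcal{I}}^\ast_{k+w},\bar{\mathcal{I}}^?_1,\ldots,\bar{\mathcal{I}}^?_{l+n-w}\}$ is the coloring of $\begin{bmatrix}\bar{\mathcal{A}}&\mathcal{B}\end{bmatrix}$. (So every diagonal location gets its own color.) Colored graph: for a colored pattern matrix $(\mathcal{M},\pi)$ with $\mathcal{M}$ of size $p\times q$, $p\le q$ (here $p=n$, $q=n+m$), $\mathcal{G}(\mathcal{M},\pi)=(V,E,\pi_E)$ is the directed graph with $V=\{1,\ldots,q\}$ and $E=\{(i,j)\in V\times V\mid \mathcal{M}_{ji}=\ast\text{ or }\mathcal{M}_{ji}=?\}$. The edges $(i,j)$ with $(j,i)\in\mathcal{I}^\ast_r$ form the set $E^\ast_r$, are solid, and have color $c_r$; the edges with $(j,i)\in\mathcal{I}^?_s$ form the set $E^?_s$, are dashed, and have color $g_s$; all these colors are distinct symbols, and $\pi_E$ is the resulting partition of $E$. Associated bipartite graph: for nonempty $X,Y\subseteq V$ with $|X|=|Y|$ (regarded as disjoint copies, since $X$ and $Y$ may share vertices of $V$), the colored bipartite graph $G=(X,Y,E_{XY},\pi_{XY})$ has edges $\{x,y\}$ for all $x\in X$, $y\in Y$ with $(x,y)\in E$, each edge inheriting its color and type (solid/dashed) from $(x,y)$; $E^\ast_{XY}$ denotes the set of solid edges. With enumerations $X=\{x_1,\ldots,x_t\}$, $Y=\{y_1,\ldots,y_t\}$, a perfect matching has the form $\{\{x_1,y_{\gamma(1)}\},\ldots,\{x_t,y_{\gamma(t)}\}\}$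 with all these pairs in $E_{XY}$ and $\gamma$ a permutation; its sign is the sign of $\gamma$; its spectrum is the multiset of colors of its edges. Two perfect matchings are equivalent if they have the same spectrum; the spectrum of an equivalence class is the common spectrum of its members, and its signature is the sum of the signs of its members. Color-perfect white neighbor: suppose each vertex of $V$ is colored black or white. For nonempty $X,Y\subseteq V$, $Y$ is a color-perfect white neighbor of $X$ if (1) $|Y|=|X|$; (2) $Y=\{y\in V\mid y\text{ is white and }(x,y)\in E\text{ for some }x\in X\}$; (3) in the associated bipartite graph $(X,Y,E_{XY},\pi_{XY})$ there exists a perfect matching, exactly one equivalence class of perfect matchings has a nonzero signature, and the spectrum of this equivalence class contains only colors corresponding to edges in $E^\ast_{XY}$ (solid edges). Color change rule: (i) initially all vertices in $V$ are white; (ii) if there exist $Y\subseteq\{1,\ldots,p\}$ and $X\subseteq\{1,\ldots,q\}$ such that $Y$ is a color-perfect white neighbor of $X$ (with respect to the current colors), change the color of all vertices in $Y$ to black; (iii) repeat step (ii) until no further color changes are possible. A derived set $\mathcal{D}$ is a set of black vertices obtained by following this procedure (it may depend on the choices made). $\mathcal{G}(\mathcal{M},\pi)$ is called colorable if there exists a derived set $\mathcal{D}=\{1,\ldots,p\}$. *)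

(* Defs.v *)
From HB Require Import structures.
From mathcomp Require Import all_boot all_order all_algebra all_fingroup.

Set Implicit Arguments.
Unset Strict Implicit.
Unset Printing Implicit Defensive.

Import Order.TTheory GRing.Theory Num.Theory.

Local Open Scope ring_scope.

Inductive symbol : Type := Zero | Star | Quest.

Definition symbol_eqb (a b : symbol) : bool :=
  match a, b with
  | Zero, Zero | Star, Star | Quest, Quest => true
  | _, _ => false
  end.

Lemma symbol_eqP : Equality.axiom symbol_eqb.
Proof. by case; case; constructor. Qed.

HB.instance Definition _ := hasDecEq.Build symbol symbol_eqP.

Section ColoredPatterns.
Variables p q : nat.
Implicit Type M : 'M[symbol]_(p, q).

Definition locations M (a : symbol) : {set 'I_p * 'I_q} :=
  [set l | M l.1 l.2 == a].

Record coloring := Coloring {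
  star_classes : {set {set 'I_p * 'I_q}};
  quest_classes : {set {set 'I_p * 'I_q}}
}.

Definition is_coloring M (pi : coloring) : bool :=
  partition (star_classes pi) (locations M Star) &&
  partition (quest_classes pi) (locations M Quest).

End ColoredPatterns.

Record colored_graph (V : finType) := ColoredGraph {
  edges : {set V * V};
  solid_colors : {set {set V * V}};
  dashed_colors : {set {set V * V}}
}.

(* The condition p <= q is encoded by q = p + m, so that the row index j is   *)
(* the vertex lshift m j.  The entry at location (j, i) is the edge (i, j).   *)
Definition edge_of p m (l : 'I_p * 'I_(p + m)) : 'I_(p + m) * 'I_(p + m) :=
  (l.2, lshift m l.1).

Definition graph_of p m (M : 'M[symbol]_(p, p + m)) (pi : coloring p (p + m)) :
    colored_graph 'I_(p + m) :=
  {| edges := [set edge_of l | l in locations M Star :|: locations M Quest];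
     solid_colors := [set @edge_of p m @: I | I : {set _} in star_classes pi];
     dashed_colors := [set @edge_of p m @: I | I : {set _} in quest_classes pi]
  |}.

Section BipartiteMatchings.
Variables (V : finType) (G : colored_graph V).

(* A color is identified with the set of all the edges that carry it.         *)
Definition color (e : V * V) : {set V * V} :=
  pblock (solid_colors G :|: dashed_colors G) e.

Definition solid_edges (X Y : {set V}) : {set V * V} :=
  [set e in edges G | [&& e.1 \in X, e.2 \in Y & e \in cover (solid_colors G)]].

(* Below, x and y enumerate the two sides of the bipartite graph.  They are   *)
(* not required to have disjoint ranges: (x i, y j) is read as an edge from   *)
(* the left copy to the right copy.                                           *)
Variables (t : nat) (x y : 'I_t -> V).

Definition perfect_matchings : {set 'S_t} :=
  [set g : 'S_t | [forall i, (x i, y (g i)) \in edges G]].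

(* Multisets of colors are represented by their multiplicity functions.       *)
Definition spectrum (g : 'S_t) : {ffun {set V * V} -> nat} :=
  [ffun c => #|[set i | color (x i, y (g i)) == c]|].

Definition matching_classes : {set {set 'S_t}} :=
  preim_partition spectrum perfect_matchings.

Definition signature (C : {set 'S_t}) : int := \sum_(g in C) (-1) ^+ odd_perm g.

End BipartiteMatchings.

Section ColorChange.
Variables (V : finType) (G : colored_graph V).

(* D is the current set of black vertices.  Another choice of enumerations    *)
(* of X and Y would only permute the perfect matchings and multiply all the   *)
(* signatures by a common sign.                                               *)
Definition color_perfect_white_neighbor (D X Y : {set V}) : Prop :=
  [/\ X != set0, Y != set0,
      Y = [set y | (y \notin D) && [exists x in X, (x, y) \in edges G]]
    & exists eqYX : #|Y| = #|X|,
      let x := fun i : 'I_#|X| => enum_val i in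
      let y := fun i : 'I_#|X| => enum_val (cast_ord (esym eqYX) i) in
      perfect_matchings G x y != set0 /\
      exists C : {set 'S_#|X|},
        unique (fun C => C \in matching_classes G x y /\ signature C != 0) C /\
        forall g c, g \in C -> (0 < spectrum G x y g c)%N ->
          c \in [set color G e | e in solid_edges G X Y]].

Variable rows : {set V}.

Inductive color_change_reachable : {set V} -> Prop :=
| color_change_init : color_change_reachable set0
| color_change_step (D X Y : {set V}) : color_change_reachable D ->
    Y \subset rows -> color_perfect_white_neighbor D X Y ->
    color_change_reachable (D :|: Y).

Definition derived_set (D : {set V}) : Prop :=
  color_change_reachable D /\
  forall X Y : {set V}, Y \subset rows -> ~ color_perfect_white_neighbor D X Y.

End ColorChange.

Definition colorable p m (M : 'M[symbol]_(p, p + m)) (pi : coloring p (p + m))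
    : Prop :=
  let rows := [set lshift m i | i : 'I_p] in
  derived_set (graph_of M pi) rows rows.

Section StructuredSystems.
Variables n m : nat.
Implicit Type A : 'M[symbol]_n.

Definition bar_pattern A : 'M[symbol]_n :=
  \matrix_(i, j)
    if i == j then (if A i i == Zero then Star else Quest) else A i j.

Definition off_diagonal (I : {set 'I_n * 'I_(n + m)}) :=
  [set l in I | lshift m l.1 != l.2].

Definition diagonal_colors A (a : symbol) : {set {set 'I_n * 'I_(n + m)}} :=
  [set [set (i, lshift m i)] | i : 'I_n & bar_pattern A i i == a].

(* Colors that become empty once the diagonal is removed carry no edge and    *)
(* are dropped, so that the result is again a pair of partitions.             *)
Definition bar_coloring A (pi : coloring n (n + m)) : coloring n (n + m) :=
  {| star_classes :=
       ([set off_diagonal I | I in star_classes pi] :\ set0)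
       :|: diagonal_colors A Star;
     quest_classes :=
       ([set off_diagonal I | I in quest_classes pi] :\ set0)
       :|: diagonal_colors A Quest |}.

End StructuredSystems.

(* Imported only here: these files shadow finset names such as set0, cover    *)
(* and partition.                                                             *)
From mathcomp Require Import all_classical all_reals all_analysis.
Import numFieldNormedType.Exports.

Definition pattern_class (R : realType) (p q : nat) (M : 'M[symbol]_(p, q))
    (pi : coloring p q) (N : 'M[R]_(p, q)) : Prop :=
  [/\ forall i j, M i j = Zero -> N i j = 0,
      forall i j, M i j = Star -> N i j != 0
    & forall I l l', I \in star_classes pi :|: quest_classes pi ->
        l \in I -> l' \in I -> N l.1 l.2 = N l'.1 l'.2].

(* Kalman controllability of x' = A x + B u: every state can be steered to    *)
(* every other one in finite time by a continuous input.                      *)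
Definition controllable (R : realType) (n m : nat) (A : 'M[R]_n)
    (B : 'M[R]_(n, m)) : Prop :=
  forall x0 x1 : 'cV[R]_n,
  exists (T : R) (u : R -> 'cV[R]_m) (x : R -> 'cV[R]_n),
    [/\ 0 < T,
        forall j, continuous (fun t : R => u t j ord0 : R),
        forall (t : R) i,
          is_derive t (1 : R) (fun s : R => x s i ord0 : R)
            ((A *m x t + B *m u t) i ord0),
        x 0 = x0
      & x T = x1].

Definition strongly_structurally_controllable (R : realType) (n m : nat)
    (A : 'M[symbol]_n) (B : 'M[symbol]_(n, m))
    (pi : coloring n (n + m)) : Prop :=
  forall (NA : 'M[R]_n) (NB : 'M[R]_(n, m)),
    pattern_class (row_mx A B) pi (row_mx NA NB) -> controllable NA NB.

(* Main.v *)
(* If [v A = a v] and [v B = 0], then [v] is a left null vector of [[A B]]     *)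
(* (a = 0) or of [[A - a I, B]] (a <> 0), and these complex matrices belong to *)
(* the colored pattern classes of the original and of the barred graph.  A     *)
(* color change on [Y] along [X] forces [v] to vanish on [Y]: the Leibniz      *)
(* expansion of the minor (Y, X), grouped by spectra, reduces to one nonzero   *)
(* integer times a product of nonzero entries.  Colorability thus gives the    *)
(* Hautus test, hence matrices with [sum_j A^j B K_j = I].                     *)
(* To steer, take a polynomial curve [y] with the same jets as [exp(tA) x0] at *)
(* 0 and [exp((t-1)A) x1] at 1, up to order n.  Then [xi = y' - A y] vanishes  *)
(* to order n at 0 and 1, so adding to [y] the correction                      *)
(* [sum_j sum_(i<j) A^(j-1-i) B K_j xi^(i)] keeps its end points, and the      *)
(* corrected curve is the trajectory for the input [u = sum_j K_j xi^(j)].     *)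
Require Import Defs.
From mathcomp Require Import all_boot all_order all_algebra all_fingroup.
From mathcomp Require Import complex ring.

Set Implicit Arguments.
Unset Strict Implicit.
Unset Printing Implicit Defensive.

Import Order.TTheory GRing.Theory Num.Theory.

Local Open Scope ring_scope.


(** A color change contributes a square subsystem of the left kernel equations, invertible by
    [det_unique_class_neq0]; so a colorable pattern has trivial left kernel for every matrix in its
    class ([colorable_left_kernel]). The original graph handles the eigenvalue 0 and the barred
    graph all others ([hautus_test]). Through Cayley-Hamilton this becomes the Kalman rank
    condition, recorded by [hautus_kalman] as an identity [\sum_j A^j B K_j = 1]. Controllability
    then follows by algebra alone: in [polynomial_steering] the matrices [K_j] turn the defect of an
    interpolating polynomial curve into an input, so state and input are both polynomial in time. *)

(** * Matchings, minors and color changes *)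

Section WeightedColoredGraph.
Variables (F : numFieldType) (V : finType) (G : colored_graph V).
Variable w : V * V -> F.
Hypothesis w_nonedge : forall e, e \notin edges G -> w e = 0.
Hypothesis w_solid : forall e, e \in cover (solid_colors G) -> w e != 0.
Hypothesis w_color :
  {in edges G &, forall e e', color G e = color G e' -> w e = w e'}.

Section Matchings.
Variables (t : nat) (x y : 'I_t -> V).

Lemma eq_spectrum_prod g h :
  g \in perfect_matchings G x y -> h \in perfect_matchings G x y ->
  spectrum G x y g = spectrum G x y h ->
  \prod_i w (x i, y (g i)) = \prod_i w (x i, y (h i)).
Proof.
(* The common weight of the edges of color [c]. A color without edges has multiplicity zero in any
   perfect matching, so the default only enters as [0 ^+ 0 = 1]. *)
pose wc c := if [pick e in edges G | color G e == c] is Some e then w e else 0.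
have prodE k : k \in perfect_matchings G x y ->
    \prod_i w (x i, y (k i)) = \prod_c wc c ^+ spectrum G x y k c.
  rewrite inE => /forallP edge_k.
  rewrite (partition_big (fun i => color G (x i, y (k i))) xpredT) //=.
  apply: eq_bigr => c _; rewrite ffunE -prodr_const.
  under [RHS]eq_bigl => i do rewrite inE.
  apply: eq_bigr => i /eqP col_i; rewrite /wc.
  case: pickP => [e /andP[eE /eqP col_e] | /(_ (x i, y (k i)))].
    by apply: w_color; rewrite ?edge_k ?col_e.
  by rewrite edge_k col_i eqxx.
by move=> gP hP eq_gh; rewrite !prodE // eq_gh.
Qed.

Lemma det_matching_classes :
  \det (\matrix_(i, j) w (x i, y j)) =
  \sum_(C in matching_classes G x y) \sum_(g in C)
    (-1) ^+ odd_perm g * \prod_i w (x i, y (g i)).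
Proof.
rewrite -(set_partition_big _ (preim_partitionP (spectrum G x y) _)) /=.
rewrite /determinant [RHS]big_mkcond; apply: eq_bigr => /= g _.
under eq_bigr => i _ do rewrite mxE.
case: ifPn => //; rewrite inE negb_forall => /existsP[i nedge].
by rewrite (bigD1 i) //= w_nonedge // mul0r mulr0.
Qed.

Lemma matching_class_sum C g :
  C \in matching_classes G x y -> g \in C ->
  \sum_(h in C) (-1) ^+ odd_perm h * \prod_i w (x i, y (h i)) =
  (signature C)%:~R * \prod_i w (x i, y (g i)).
Proof.
have partP := preim_partitionP (spectrum G x y) (perfect_matchings G x y).
move=> CP gC; rewrite /signature rmorph_sum /= mulr_suml.
have subC h : h \in C -> h \in perfect_matchings G x y.
  by move=> hC; rewrite -(cover_partition partP); apply/bigcupP; exists C.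
apply: eq_bigr => h hC; rewrite rmorphXn rmorphN1; congr (_ * _).
apply: eq_spectrum_prod; rewrite ?subC //.
case/and3P: (partP) => _ tI _.
have := hC; rewrite -(def_pblock tI CP gC) pblock_equivalence_partition ?subC //.
  by move/eqP.
by split=> // /eqP->.
Qed.

(** Each class contributes its signature times one product of weights, so only [C] survives in the
    determinant. Its signature stays nonzero in [F] by characteristic zero, and its product has only
    solid, hence nonzero, factors. *)
Lemma det_unique_class_neq0 C (X Y : {set V}) :
  unique (fun C => C \in matching_classes G x y /\ signature C != 0) C ->
  (forall g c, g \in C -> (0 < spectrum G x y g c)%N ->
     c \in [set color G e | e in solid_edges G X Y]) ->
  \det (\matrix_(i, j) w (x i, y j)) != 0.
Proof.
have partP := preim_partitionP (spectrum G x y) (perfect_matchings G x y).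
move=> [[CP sigC] uniqC] solidC.
have /set0Pn[g gC] : C != set0.
  by apply: contraNneq sigC => ->; rewrite /signature big_set0.
rewrite det_matching_classes (bigD1 C) //= (matching_class_sum CP gC).
have other0 C' : C' \in matching_classes G x y -> C' != C ->
    \sum_(h in C') (-1) ^+ odd_perm h * \prod_i w (x i, y (h i)) = 0.
  move=> C'P neqC'; have sigC' : signature C' = 0.
    apply/eqP; apply: contraNT neqC' => sigC'.
    by rewrite (uniqC C').
  case: (set_0Vmem C') => [->|[h hC']]; first by rewrite big_set0.
  by rewrite (matching_class_sum C'P hC') sigC' mul0r.
rewrite [X in _ + X]big1 => [|C' /andP[C'P neqC']]; last exact: other0.
rewrite addr0 mulf_neq0 ?intr_eq0 //; apply/prodf_neq0 => i _.
have edge_i : (x i, y (g i)) \in edges G.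
  have: g \in perfect_matchings G x y.
    by rewrite -(cover_partition partP); apply/bigcupP; exists C.
  by rewrite inE => /forallP.
have /imsetP[e] : color G (x i, y (g i)) \in
    [set color G e | e in solid_edges G X Y].
  apply: (solidC g) => //; rewrite ffunE card_gt0.
  by apply/set0Pn; exists i; rewrite inE.
rewrite inE => /and4P[eE _ _ solid_e] col_e.
by rewrite (w_color edge_i eE col_e) w_solid.
Qed.

End Matchings.

Lemma black_vertices_kernel (rows : {set V}) (z : V -> F) (D : {set V}) :
  (forall x, \sum_y z y * w (x, y) = 0) ->
  color_change_reachable G rows D -> {in D, forall y, z y = 0}.
Proof.
move=> ker_z; elim=> {D} [y|D X Y _ zD _]; first by rewrite inE.
case=> _ _ defY [eqYX /=]; set x := fun i => enum_val i.
set y := fun i => enum_val _ => -[_ [C [uniqC solidC]]].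
have detS := det_unique_class_neq0 uniqC solidC.
set S := \matrix_(i, j) _ in detS.
(* In the equation at a vertex of [X], a vertex outside [Y] is either black, where [z] vanishes by
   induction, or not a neighbor, where the weight vanishes. *)
have Sz0 : S *m \col_j z (y j) = 0.
  apply/matrixP => i j; rewrite mxE [RHS]mxE -[RHS](ker_z (x i)).
  rewrite [RHS](bigID (mem Y)) /= [X in _ = _ + X]big1 ?addr0.
    rewrite [RHS]big_enum_val [RHS](reindex (cast_ord (esym eqYX))) /=.
      by apply: eq_bigr => k _; rewrite !mxE mulrC.
    apply: onW_bij; exists (cast_ord eqYX) => k.
      by rewrite cast_ordKV.
    by rewrite cast_ordK.
  move=> v; rewrite {1}defY inE negb_and negbK => /orP[/zD->|]; rewrite ?mul0r//.
  rewrite negb_exists => /forallP/(_ (x i)); rewrite enum_valP => nedge.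
  by rewrite w_nonedge ?mulr0.
have z0 : \col_j z (y j) = 0.
  have unitS : S \in unitmx by rewrite unitmxE unitfE.
  by rewrite -(mulKmx unitS (\col_j z (y j))) Sz0 mulmx0.
move=> v; rewrite inE => /orP[/zD//|vY].
have := congr1 (fun M : 'cV_ _ => M (cast_ord eqYX (enum_rank_in vY v)) 0) z0.
by rewrite !mxE /y cast_ordK enum_rankK_in.
Qed.

End WeightedColoredGraph.

(** * Left kernels of colorable patterns *)

Section ColoredPatternKernel.
Variables (F : numFieldType) (p m : nat) (M : 'M[symbol]_(p, p + m)).
Variables (pi : coloring p (p + m)) (N : 'M[F]_(p, p + m)).
Hypothesis N_zero : forall i j, M i j = Zero -> N i j = 0.
Hypothesis N_star : forall I l, I \in star_classes pi -> l \in I ->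
  N l.1 l.2 != 0.
Hypothesis colored : forall i j, M i j != Zero ->
  exists2 I, I \in star_classes pi :|: quest_classes pi & (i, j) \in I.
Hypothesis N_color : forall I l l',
  I \in star_classes pi :|: quest_classes pi -> l \in I -> l' \in I ->
  N l.1 l.2 = N l'.1 l'.2.

Lemma colorable_left_kernel (v : 'rV[F]_p) :
  colorable M pi -> v *m N = 0 -> v = 0.
Proof.
move=> [reach _] vN.
(* Only the first [p] vertices receive edges; zero rows in [N] and zero entries in [v] extend the
   kernel equations to all vertices. *)
pose w (e : 'I_(p + m) * 'I_(p + m)) : F := (col_mx N (0 : 'M_(m, p + m))) e.2 e.1.
pose z y : F := row_mx v (0 : 'rV_m) 0 y.
have wE l : w (edge_of l) = N l.1 l.2 by rewrite /w /= col_mxEu.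
have colors_image : solid_colors (graph_of M pi) :|: dashed_colors (graph_of M pi)
    = [set @edge_of p m @: I | I : {set _} in star_classes pi :|: quest_classes pi].
  by rewrite /= imsetU.
suff z0 : {in [set lshift m i | i : 'I_p], forall y, z y = 0}.
  apply/matrixP => i j; rewrite ord1 [RHS]mxE -(row_mxEl v (0 : 'rV_m)).
  by apply: z0; apply: imset_f.
have edge_colored e : e \in edges (graph_of M pi) -> e \in cover
    (solid_colors (graph_of M pi) :|: dashed_colors (graph_of M pi)).
  move=> /imsetP[[i j] l_edge ->].
  have [|I Ipi lI] := @colored i j.
    by move: l_edge; rewrite !inE /= => /orP[] /eqP->.
  apply/bigcupP; exists (@edge_of p m @: I); last exact: imset_f.
  by rewrite colors_image; apply: imset_f.
apply: (black_vertices_kernel (w := w) _ _ _ _ reach).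
- case=> x y; rewrite /w /=; case: (split_ordP y) => i -> nedge; last first.
    by rewrite col_mxEd mxE.
  rewrite col_mxEu; apply: N_zero; apply/eqP; apply: contraNT nedge => Mix.
  apply/imsetP; exists (i, x) => //; rewrite !inE /=.
  by case: (M i x) Mix.
- move=> e /bigcupP[J]; rewrite /= => /imsetP[I Ipi ->] /imsetP[l lI ->].
  by rewrite wE; apply: N_star lI.
- move=> e e' eE e'E col_ee'.
  have := pblock_mem (edge_colored e eE); rewrite {2}colors_image.
  move=> /imsetP[I Ipi defI].
  have: e' \in color (graph_of M pi) e.
    by rewrite col_ee' mem_pblock edge_colored.
  have: e \in color (graph_of M pi) e by rewrite mem_pblock edge_colored.
  rewrite /color defI => /imsetP[l lI ->] /imsetP[l' l'I ->].
  by rewrite !wE; apply: N_color Ipi lI l'I.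
- move=> x; transitivity ((row_mx v (0 : 'rV_m) *m col_mx N (0 : 'M_(m, p + m))) 0 x).
    by rewrite mxE.
  by rewrite mul_row_col vN mul0mx addr0 mxE.
Qed.
End ColoredPatternKernel.

(** * The Hautus test from the two graphs *)

Section HautusTest.
Variables (F : numFieldType) (n m : nat).
Variables (A : 'M[symbol]_n) (B : 'M[symbol]_(n, m)) (pi : coloring n (n + m)).
Variables (NA : 'M[F]_n) (NB : 'M[F]_(n, m)).
Let M := row_mx A B.
Let N := row_mx NA NB.
Hypothesis pi_coloring : is_coloring M pi.
Hypothesis N_zero : forall i j, M i j = Zero -> N i j = 0.
Hypothesis N_star : forall i j, M i j = Star -> N i j != 0.
Hypothesis N_color : forall I l l',
  I \in star_classes pi :|: quest_classes pi -> l \in I -> l' \in I ->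
  N l.1 l.2 = N l'.1 l'.2.

Lemma star_class_neq0 I l : I \in star_classes pi -> l \in I -> N l.1 l.2 != 0.
Proof.
move=> Ipi lI; apply: N_star; case/andP: pi_coloring => /cover_partition cov _.
have : l \in locations M Star by rewrite -cov; apply/bigcupP; exists I.
by rewrite inE => /eqP.
Qed.

Lemma nonzero_colored i j : M i j != Zero ->
  exists2 I, I \in star_classes pi :|: quest_classes pi & (i, j) \in I.
Proof.
case/andP: pi_coloring => /cover_partition covS /cover_partition covQ.
case Mij: (M i j) => // _.
  have : (i, j) \in locations M Star by rewrite inE Mij.
  by rewrite -covS => /bigcupP[I Ipi ijI]; exists I; rewrite // inE Ipi.
have : (i, j) \in locations M Quest by rewrite inE Mij.
by rewrite -covQ => /bigcupP[I Ipi ijI]; exists I; rewrite // inE Ipi orbT.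
Qed.

Section NonzeroEigenvalue.
Variable a : F.
Hypothesis a_neq0 : a != 0.
Let Mbar := row_mx (bar_pattern A) B.
Let Nbar := row_mx (NA - a%:M) NB.

Lemma shift_offdiag i j : lshift m i != j -> Nbar i j = N i j.
Proof.
rewrite /Nbar /N; case: (split_ordP j) => k -> neq_ij; last by rewrite !row_mxEr.
rewrite !row_mxEl !mxE; case: (eqVneq i k) neq_ij => [->|_ _]; first by rewrite eqxx.
by rewrite subr0.
Qed.

Lemma bar_offdiag i j : lshift m i != j -> Mbar i j = M i j.
Proof.
rewrite /Mbar /M; case: (split_ordP j) => k -> neq_ij; last by rewrite !row_mxEr.
by rewrite !row_mxEl mxE; case: (eqVneq i k) neq_ij => // ->; rewrite eqxx.
Qed.

Lemma bar_class_split I :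
  I \in star_classes (bar_coloring A pi) :|: quest_classes (bar_coloring A pi) ->
  (exists2 J, J \in star_classes pi :|: quest_classes pi & I = off_diagonal J) \/
  exists i, I = [set (i, lshift m i)].
Proof.
rewrite /= !in_setU !in_setD1 => /orP[] /orP[/andP[_ /imsetP[J Jpi ->]] | /imsetP[i _ ->]].
- by left; exists J; rewrite // inE Jpi.
- by right; exists i.
- by left; exists J; rewrite // inE Jpi orbT.
- by right; exists i.
Qed.

(** The shift turns a zero diagonal entry of the pattern into [- a != 0], hence a star, and any
    other one into an unconstrained value. It also breaks equalities between diagonal and
    off-diagonal entries, which is why diagonal locations get private colors. *)
Lemma bar_left_kernel (v : 'rV[F]_n) :
  colorable Mbar (bar_coloring A pi) -> v *m Nbar = 0 -> v = 0.
Proof.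
apply: colorable_left_kernel => [i j|I l||I l l'].
- have [<-|neq_ij] := eqVneq (lshift m i) j.
    by rewrite row_mxEl mxE eqxx; case: ifP.
  by rewrite bar_offdiag // shift_offdiag //; apply: N_zero.
- rewrite /= in_setU in_setD1 => /orP[/andP[_ /imsetP[J Jpi ->]] | /imsetP[i + ->]].
    rewrite inE => /andP[lJ off_l]; rewrite shift_offdiag //.
    exact: star_class_neq0 Jpi lJ.
  rewrite !inE mxE eqxx => Aii /eqP-> /=.
  have NAii : NA i i = 0.
    rewrite -(row_mxEl NA NB); apply: N_zero.
    by rewrite /M row_mxEl; case: (A i i) Aii.
  by rewrite row_mxEl !mxE NAii eqxx sub0r oppr_eq0.
- move=> i j; have [<- _|neq_ij] := eqVneq (lshift m i) j.
    exists [set (i, lshift m i)]; rewrite ?set11 // !inE.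
    case Aii: (bar_pattern A i i).
    + by move: Aii; rewrite mxE eqxx; case: ifP.
    + by apply/orP; left; apply/orP; right; apply/imsetP; exists i; rewrite ?inE ?Aii.
    + by apply/orP; right; apply/orP; right; apply/imsetP; exists i; rewrite ?inE ?Aii.
  rewrite bar_offdiag // => /nonzero_colored[J Jpi ijJ].
  have offJ : (i, j) \in off_diagonal J by rewrite inE ijJ.
  exists (off_diagonal J) => //.
  have nz : off_diagonal J != set0 by apply/set0Pn; exists (i, j).
  move: Jpi; rewrite !inE => /orP[] Jpi.
    by rewrite nz imset_f.
  by rewrite nz [off_diagonal J \in [set _ | _ in quest_classes pi]]imset_f ?orbT.
- move=> /bar_class_split[[J Jpi ->]|[i ->]].
    rewrite !inE => /andP[lJ off_l] /andP[l'J off_l'].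
    by rewrite !shift_offdiag //; apply: N_color Jpi lJ l'J.
  by rewrite !inE => /eqP-> /eqP->.
Qed.

End NonzeroEigenvalue.

Lemma hautus_test (a : F) (v : 'rV[F]_n) :
  colorable M pi ->
  colorable (row_mx (bar_pattern A) B) (bar_coloring A pi) ->
  v *m NA = a *: v -> v *m NB = 0 -> v = 0.
Proof.
move=> colM colbar vNA vNB; have [a0|a_neq0] := eqVneq a 0.
  apply: (colorable_left_kernel (N := N) N_zero _ nonzero_colored N_color colM).
    exact: star_class_neq0.
  by rewrite mul_mx_row vNA vNB a0 scale0r row_mx0.
apply: (bar_left_kernel a_neq0 colbar).
by rewrite mul_mx_row mulmxBr vNA mul_mx_scalar subrr vNB row_mx0.
Qed.

End HautusTest.


(** * From the Hautus test to the Kalman condition *)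

(** Peel off one linear factor: by induction [v *m (A - a%:M)] is zero, so [v] is a left eigenvector
    killed by [B]. *)
Lemma hautus_unobservable (F : fieldType) n m (A : 'M[F]_n) (B : 'M[F]_(n, m))
    (s : seq F) (v : 'rV[F]_n) :
  (forall (a : F) (w : 'rV_n), w *m A = a *: w -> w *m B = 0 -> w = 0) ->
  v *m \prod_(a <- s) (A - a%:M) = 0 ->
  (forall j, (j < size s)%N -> v *m A ^+ j *m B = 0) -> v = 0.
Proof.
move=> hautus; elim: s v => [|a s IHs] v; first by rewrite big_nil mulmx1.
rewrite big_cons mulmxA => /IHs{}IHs vAB.
have /IHs /eqP : forall j, (j < size s)%N -> v *m (A - a%:M) *m A ^+ j *m B = 0.
  move=> j lt_js; rewrite mulmxBr mul_mx_scalar !mulmxBl -!scalemxAl.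
  rewrite (vAB j) ?(leqW lt_js) // scaler0 subr0.
  by have := vAB j.+1 lt_js; rewrite exprS mulmxA.
rewrite mulmxBr mul_mx_scalar subr_eq0 => /eqP /hautus; apply.
by have := vAB 0 isT; rewrite expr0 mulmx1.
Qed.

Lemma hautus_kalman (R : rcfType) n m (A : 'M[R]_n) (B : 'M[R]_(n, m)) :
  (forall (a : R[i]) (w : 'rV[R[i]]_n),
     w *m map_mx (real_complex R) A = a *: w ->
     w *m map_mx (real_complex R) B = 0 -> w = 0) ->
  exists K : 'I_n -> 'M[R]_(m, n), \sum_(j < n) A ^+ j *m B *m K j = 1%:M.
Proof.
case: n A B => [|n] A B hautus.
  by exists (fun=> 0); apply/matrixP => -[].
pose S := (\sum_(j < n.+1) <<(A ^+ j *m B)^T>>)%MS.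
have full_S : cokermx S = 0.
  apply/matrixP => i k; rewrite [RHS]mxE.
  (* A row orthogonal to every column of the Kalman matrix. It is real, but is shown to vanish over
     [R[i]], where the characteristic polynomial splits. *)
  pose w := (col k (cokermx S))^T.
  have wAB j : (j < n.+1)%N -> w *m A ^+ j *m B = 0.
    move=> lt_jn; apply: trmx_inj; rewrite trmx0 -mulmxA trmx_mul trmxK.
    have /eqP cokerS : (A ^+ j *m B)^T *m cokermx S == 0.
      rewrite -submxE.
      by rewrite (sumsmx_sup (Ordinal lt_jn)) // genmxE.
    by rewrite colE mulmxA cokerS mul0mx.
  have w0 : map_mx (real_complex R) w = 0.
    have [s def_s] := closed_field_poly_normal (char_poly (map_mx (real_complex R) A)).
    have monicA := char_poly_monic (map_mx (real_complex R) A).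
    move: def_s; rewrite (monicP monicA) scale1r => def_s.
    have size_s : size s = n.+1.
      by have := size_char_poly (map_mx (real_complex R) A); rewrite def_s size_prod_XsubC => -[].
    apply: (hautus_unobservable (s := s) hautus).
      have := Cayley_Hamilton (map_mx (real_complex R) A); rewrite def_s rmorph_prod /=.
      under eq_bigr => a _ do rewrite rmorphB /= horner_mx_X horner_mx_C.
      by move=> ->; rewrite mulmx0.
    move=> j; rewrite size_s => lt_jn.
    by rewrite -rmorphXn -!map_mxM wAB // map_mx0.
  have := congr1 (fun M : 'rV_ _ => M 0 i) w0; rewrite !mxE => /eqP.
  by rewrite fmorph_eq0 => /eqP.
have /sub_sumsmxP[u def1] : (1%:M <= S)%MS by rewrite submxE full_S mulmx0.
have sub1 j : (u j *m <<(A ^+ j *m B)^T>>%MS <= (A ^+ j *m B)^T)%MS.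
  by rewrite (submx_trans (submxMl _ _)) ?genmxE.
(* The [j]-th summand of the identity lies in the row space of [(A ^+ j *m B)^T]; the pseudo-inverse
   extracts its coefficients. *)
exists (fun j => (u j *m <<(A ^+ j *m B)^T>>%MS *m pinvmx (A ^+ j *m B)^T)^T).
apply: trmx_inj; rewrite trmx1 def1 raddf_sum; apply: eq_bigr => j _ /=.
by rewrite trmx_mul trmxK mulmxKpV.
Qed.


(** * Two-point Hermite interpolation *)

Section HermiteInterpolation.
Variable F : numFieldType.
Implicit Types (p q : {poly F}) (a : F).

Lemma derivn_horner_dvdp a N p i :
  ('X - a%:P) ^+ N %| p -> (i < N)%N -> p^`(i).[a] = 0.
Proof.
elim: i N p => [|i IHi] [|N] p // /dvdpP[q ->] lt_iN.
  by rewrite derivn0 !hornerE subrr exprS mul0r mulr0.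
rewrite derivSn; apply: (IHi N) => //.
rewrite derivM deriv_exp derivXsubC mul1r /= dvdp_add //.
  by rewrite dvdp_mull // exprS dvdp_mulIr.
by rewrite mulrnAr -mulrnAl dvdp_mulIr.
Qed.

Lemma taylor_jet a (c : nat -> F) N :
  exists p, forall i, (i < N)%N -> p^`(i).[a] = c i.
Proof.
pose g := \poly_(k < N) (c k / k`!%:R).
exists (g \Po ('X - a%:P)) => i lt_iN.
have -> : (g \Po ('X - a%:P))^`(i) = g^`(i) \Po ('X - a%:P).
  elim: i {lt_iN} => // i IHi.
  by rewrite !derivnS IHi deriv_comp derivB derivX derivC subr0 mulr1.
rewrite horner_comp !hornerE subrr horner_coef0 coef_derivn addn0 ffactnn.
by rewrite coef_poly lt_iN -[LHS]mulr_natr divfK // pnatr_eq0 -lt0n fact_gt0.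
Qed.

Lemma hermite_jets a b (c d : nat -> F) N : a != b ->
  exists p, forall i, (i < N)%N -> p^`(i).[a] = c i /\ p^`(i).[b] = d i.
Proof.
move=> neq_ab; have [f jet_f] := taylor_jet a c N; have [g jet_g] := taylor_jet b d N.
have : coprimep (('X - a%:P) ^+ N) (('X - b%:P) ^+ N).
  by rewrite coprimep_expl // coprimep_expr // coprimep_XsubC root_XsubC eq_sym.
case/Bezout_eq1_coprimepP => -[u v] /= bezout.
exists (f + (g - f) * (u * ('X - a%:P) ^+ N)) => i lt_iN; split.
  rewrite derivnD hornerD jet_f // (derivn_horner_dvdp (N := N)) ?addr0 //.
  by rewrite mulrA dvdp_mull.
(* By the Bezout relation the same polynomial is also a perturbation of [g] vanishing to order [N]
   at [b]. *)
rewrite (_ : f + _ = g + (f - g) * (v * ('X - b%:P) ^+ N)).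
  rewrite derivnD hornerD jet_g // (derivn_horner_dvdp (N := N)) ?addr0 //.
  by rewrite mulrA dvdp_mull.
move/(canRL (addrK _)): bezout => ->.
by ring.
Qed.

End HermiteInterpolation.

(** * Steering along polynomial curves *)

Section PolynomialSteering.
Variables (F : numFieldType) (n m : nat) (A : 'M[F]_n) (B : 'M[F]_(n, m)).

Definition deriv_mx k (y : 'cV[{poly F}]_k) : 'cV[{poly F}]_k := map_mx (@deriv F) y.
Definition eval_mx k (a : F) (y : 'cV[{poly F}]_k) : 'cV[F]_k := map_mx (horner^~ a) y.
Definition polyC_mul k l (M : 'M[F]_(k, l)) (y : 'cV[{poly F}]_l) : 'cV[{poly F}]_k :=
  map_mx polyC M *m y.

Lemma deriv_polyC_mul k l (M : 'M[F]_(k, l)) y :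
  deriv_mx (polyC_mul M y) = polyC_mul M (deriv_mx y).
Proof.
apply/matrixP => i j; rewrite !mxE (raddf_sum (@deriv F)); apply: eq_bigr => r _ /=.
by rewrite !mxE derivM derivC mul0r add0r.
Qed.

Lemma eval_polyC_mul k l (M : 'M[F]_(k, l)) y a :
  eval_mx a (polyC_mul M y) = M *m eval_mx a y.
Proof.
apply/matrixP => i j; rewrite !mxE horner_sum; apply: eq_bigr => r _.
by rewrite !mxE hornerM hornerC.
Qed.

Lemma iter_deriv_mx k (y : 'cV[{poly F}]_k) i r :
  iter i (@deriv_mx k) y r 0 = (y r 0)^`(i).
Proof. by elim: i => [|i IHi]; rewrite ?derivn0 // iterS mxE IHi. Qed.

Lemma iter_deriv_polyC_mul k l (M : 'M[F]_(k, l)) y i :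
  iter i (@deriv_mx k) (polyC_mul M y) = polyC_mul M (iter i (@deriv_mx l) y).
Proof. by elim: i => // i IHi; rewrite !iterS IHi deriv_polyC_mul. Qed.

Lemma deriv_mxD k : {morph @deriv_mx k : y z / y + z}.
Proof. by move=> y z; apply/matrixP => i j; rewrite !mxE derivD. Qed.

Lemma deriv_mxB k : {morph @deriv_mx k : y z / y - z}.
Proof. by move=> y z; apply/matrixP => i j; rewrite !mxE derivB. Qed.

Lemma eval_mxD k a : {morph @eval_mx k a : y z / y + z}.
Proof. by move=> y z; apply/matrixP => i j; rewrite !mxE hornerD. Qed.

Lemma eval_mxB k a : {morph @eval_mx k a : y z / y - z}.
Proof. by move=> y z; apply/matrixP => i j; rewrite !mxE !hornerE. Qed.

Lemma polyC_mulA k l r (M : 'M[F]_(k, l)) (N : 'M[F]_(l, r)) y :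
  polyC_mul M (polyC_mul N y) = polyC_mul (M *m N) y.
Proof. by rewrite /polyC_mul mulmxA -map_mxM. Qed.

Lemma polyC_mulD k l (M : 'M[F]_(k, l)) : {morph polyC_mul M : y z / y + z}.
Proof. exact: mulmxDr. Qed.

Lemma polyC_mulB k l (M : 'M[F]_(k, l)) : {morph polyC_mul M : y z / y - z}.
Proof. exact: mulmxBr. Qed.

Lemma polyC_mul_sum k l (M : 'M[F]_(k, l)) (f : 'I_n -> 'cV_l) :
  polyC_mul M (\sum_i f i) = \sum_i polyC_mul M (f i).
Proof. exact: mulmx_sumr. Qed.

Lemma polyC_mul_suml k l (f : 'I_n -> 'M[F]_(k, l)) y :
  polyC_mul (\sum_i f i) y = \sum_i polyC_mul (f i) y.
Proof. by rewrite /polyC_mul raddf_sum mulmx_suml. Qed.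

(** Differentiation [D] commutes with the constant matrix [A], so [D^j - A^j] factors as [D - A]
    times the sum of the [A^(j-1-i) D^i] for [i < j]. The witness is this sum applied to [g]; it
    involves only derivatives of order below [j], which vanish at the ends. *)
Lemma derivn_minus_pow (ends : {pred F}) j (g : 'cV[{poly F}]_n) :
  (forall i a, (i < j)%N -> a \in ends -> eval_mx a (iter i (@deriv_mx n) g) = 0) ->
  exists2 x, {in ends, forall a, eval_mx a x = 0}
    & deriv_mx x - polyC_mul A x = iter j (@deriv_mx n) g - polyC_mul (A ^+ j) g.
Proof.
elim: j => [_|j IHj g_ends].
  exists 0 => [a _|].
    by apply/matrixP => i j; rewrite !mxE horner0.
  rewrite /polyC_mul mulmx0 expr0 map_mx1 mul1mx !subrr.
  by apply/matrixP => i j; rewrite !mxE deriv0 subrr.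
have [|x x_ends eq_x] := IHj.
  by move=> i a lt_ij; apply: g_ends; apply: leqW.
exists (polyC_mul A x + iter j (@deriv_mx n) g).
  by move=> a a_end; rewrite eval_mxD eval_polyC_mul x_ends // mulmx0 add0r g_ends.
rewrite deriv_mxD deriv_polyC_mul (canRL (subrK _) eq_x) exprS -polyC_mulA -iterS.
rewrite 2!polyC_mulD polyC_mulB.
move: (polyC_mul A (iter j _ g)) (polyC_mul A (polyC_mul _ g)) => P Q.
move: (polyC_mul A (polyC_mul A x)) (iter j.+1 _ g) => T S.
rewrite (addrC T P) opprD !addrA (addrAC _ S) (addrAC _ S) (addrAC _ T) addrK.
by rewrite (addrAC P) subrr add0r addrC.
Qed.

Lemma polynomial_steering (K : 'I_n -> 'M[F]_(m, n)) (a b : F) (xa xb : 'cV[F]_n) :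
  \sum_(j < n) A ^+ j *m B *m K j = 1%:M -> a != b ->
  exists x u, [/\ deriv_mx x = polyC_mul A x + polyC_mul B u,
    eval_mx a x = xa & eval_mx b x = xb].
Proof.
move=> sumK neq_ab.
(* The jets are those of free motions through [xa] and [xb]. Orders up to [n] included are needed
   because the [i]-th derivative of the defect [xi], for [i < n], involves the derivative of [Y] of
   order [i.+1]. *)
have /fin_all_exists[y jet_y] : forall r : 'I_n, exists p : {poly F},
    forall i, (i < n.+1)%N -> p^`(i).[a] = (A ^+ i *m xa) r 0 /\ p^`(i).[b] = (A ^+ i *m xb) r 0.
  by move=> r; apply: hermite_jets.
pose Y : 'cV_n := \col_r y r.
have Ya i : (i <= n)%N -> eval_mx a (iter i (@deriv_mx n) Y) = A ^+ i *m xa.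
  move=> le_in; apply/matrixP => r k.
  by rewrite !ord1 mxE iter_deriv_mx mxE (jet_y r i le_in).1.
have Yb i : (i <= n)%N -> eval_mx b (iter i (@deriv_mx n) Y) = A ^+ i *m xb.
  move=> le_in; apply/matrixP => r k.
  by rewrite !ord1 mxE iter_deriv_mx mxE (jet_y r i le_in).2.
pose xi := deriv_mx Y - polyC_mul A Y.
have iter_xi i : iter i (@deriv_mx n) xi =
    iter i.+1 (@deriv_mx n) Y - polyC_mul A (iter i (@deriv_mx n) Y).
  elim: i => // i IHi.
  by rewrite iterS IHi deriv_mxB deriv_polyC_mul.
have xi_ends i c : (i < n)%N -> c \in pred2 a b ->
    eval_mx c (iter i (@deriv_mx n) xi) = 0.
  move=> lt_in; rewrite iter_xi eval_mxB eval_polyC_mul !inE => /orP[] /eqP->.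
    by rewrite !Ya ?(ltnW lt_in) // mulmxA exprS subrr.
  by rewrite !Yb ?(ltnW lt_in) // mulmxA exprS subrr.
have /fin_all_exists2[x x_ends eq_x] : forall j : 'I_n, exists2 x : 'cV[{poly F}]_n,
    {in pred2 a b, forall c, eval_mx c x = 0}
    & deriv_mx x - polyC_mul A x =
      iter j (@deriv_mx n) (polyC_mul (B *m K j) xi)
      - polyC_mul (A ^+ j) (polyC_mul (B *m K j) xi).
  move=> j; apply: derivn_minus_pow => i c lt_ij c_end.
  rewrite iter_deriv_polyC_mul eval_polyC_mul xi_ends ?mulmx0 //.
  exact: ltn_trans lt_ij (ltn_ord j).
have evalX c : c \in pred2 a b -> eval_mx c (Y + \sum_j x j) = eval_mx c Y.
  move=> c_end; rewrite eval_mxD.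
  rewrite (big_morph _ (eval_mxD c) (_ : _ = 0)) ?big1 ?addr0 // => [j _|].
    exact: x_ends.
  by apply/matrixP => i j; rewrite !mxE horner0.
exists (Y + \sum_j x j), (\sum_j polyC_mul (K j) (iter j (@deriv_mx n) xi)); split.
- rewrite [RHS]addrC; apply/eqP; rewrite -subr_eq; apply/eqP.
  rewrite deriv_mxD.
  rewrite (big_morph _ (@deriv_mxD n) (_ : _ = 0)); last first.
    by apply/matrixP => i j; rewrite !mxE deriv0.
  rewrite polyC_mulD !polyC_mul_sum opprD addrACA -sumrB -/xi.
  under eq_bigr => j _ do rewrite eq_x iter_deriv_polyC_mul polyC_mulA -(polyC_mulA B).
  (* The terms [A^j B K_j xi] add up to [xi] by [sumK] and cancel the defect, leaving exactly [B]
     times the input. *)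
  rewrite sumrB -polyC_mul_suml.
  under [X in polyC_mul X xi]eq_bigr => j _ do rewrite mulmxA.
  by rewrite sumK /polyC_mul map_mx1 mul1mx addrC subrK.
- by rewrite evalX ?inE ?eqxx // (Ya 0%N) // expr0 mul1mx.
- by rewrite evalX ?inE ?eqxx ?orbT // (Yb 0%N) // expr0 mul1mx.
Qed.

End PolynomialSteering.

(* Imported only here: these files shadow finset names such as set0 and cover. *)
From mathcomp Require Import all_classical all_reals all_analysis.
Import numFieldNormedType.Exports.

Theorem theorem18 (R : realType) (n m : nat)
    (A : 'M[symbol]_n) (B : 'M[symbol]_(n, m)) (pi : coloring n (n + m))
    (hpi : is_coloring (row_mx A B) pi)
    (hAB : colorable (row_mx A B) pi)
    (hbar : colorable (row_mx (bar_pattern A) B) (bar_coloring A pi)) :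
  strongly_structurally_controllable R A B pi.
Proof.
move=> NA NB [N_zero N_star N_color] x0 x1.
have [K sumK] : exists K : 'I_n -> 'M[R]_(m, n),
    \sum_(j < n) NA ^+ j *m NB *m K j = 1%:M.
  (* Eigenvalues may be complex; the embedding into [R[i]] is an injective ring morphism, so the
     pattern constraints on zeros, nonzeros and equal entries carry over. *)
  apply: hautus_kalman => a w.
  apply: (hautus_test hpi _ _ _ hAB hbar); rewrite -map_row_mx.
  - by move=> i j Mij; rewrite mxE N_zero ?rmorph0.
  - by move=> i j Mij; rewrite mxE fmorph_eq0 N_star.
  - by move=> I l l' Ipi lI l'I; rewrite [LHS]mxE [RHS]mxE (N_color I l l').
have zero_neq1 : (0 : R) != 1 by rewrite eq_sym oner_neq0.
have [x [u [dyn_xu x_start x_end]]] :=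
  polynomial_steering x0 x1 sumK zero_neq1.
exists 1, (fun t => eval_mx t u), (fun t => eval_mx t x); split=> //.
- move=> j; rewrite (_ : (fun t => _) = horner (u j ord0)).
    exact: continuous_horner.
  by apply: funext => t; rewrite mxE.
- move=> t i; rewrite (_ : (fun s => _) = horner (x i ord0)); last first.
    by apply: funext => s; rewrite mxE.
  rewrite -!eval_polyC_mul -eval_mxD -dyn_xu !mxE.
  exact: is_derive_poly.
Qed.
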